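(* Let $X$ be a complex Banach space of dimension at least $2$, and let $M_0,M_\infty$ be closed subspaces of $X$ with $M_0\cap M_\infty=\{0\}$ and $M_0+M_\infty=X$, and let $U\colon M_0\to M_\infty$ be an invertible bounded linear operator. For $\omega\in\mathbb{C}$ put $M_\omega=\{x_0+\omega Ux_0: x_0\in M_0\}$, and let $\mathfrak{T}_U=\bigl\{\{0\},M_0,M_1,M_\infty,X\bigr\}$. Then the subspace lattice $\mathfrak{T}_U$ is not reflexive, since $$\operatorname{Lat}\operatorname{Alg}(\mathfrak{T}_U)=\bigl\{M_\omega:\ \omega\in\mathbb{C}\cup\{\infty\}\bigr\}\cup\bigl\{\{0\},X\bigr\}.$$ In particular, if $\mathfrak{T}$ is a double triangle subspace lattice in a finite-dimensional complex Banach space, then $\mathfrak{T}$ is not reflexive.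
   Context: A subspace of $X$ means a closed linear subspace; $\mathfrak{C}(X)$ is the family of all subspaces of $X$; $M\vee N=\overline{M+N}$, $M\wedge N=M\cap N$. $\mathcal{B}(X)$ is the algebra of bounded linear operators on $X$; $\operatorname{Alg}(\mathfrak{F})=\{A\in\mathcal{B}(X): AM\subseteq M\text{ for all }M\in\mathfrak{F}\}$; $\operatorname{Lat}(\mathcal{T})=\{M\in\mathfrak{C}(X): TM\subseteq M\text{ for all }T\in\mathcal{T}\}$. A subspace lattice $\mathfrak{L}$ is reflexive if $\operatorname{Lat}\operatorname{Alg}(\mathfrak{L})=\mathfrak{L}$. A double triangle subspace lattice in $X$ is a family of five distinct subspaces $\{\{0\},K,L,M,X\}$ such that $K\wedge L=K\wedge M=L\wedge M=\{0\}$ and $K\vee L=K\vee M=L\vee M=X$. The family $\mathfrak{T}_U$ is a double triangle subspace lattice. *)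

(* Defs.v *)
From HB Require Import structures.
From mathcomp Require Import all_boot all_order all_algebra.
From mathcomp Require Import complex.
From mathcomp Require Import all_classical all_reals all_analysis.
Import Order.TTheory GRing.Theory Num.Theory.
Import numFieldNormedType.Exports.

Set Implicit Arguments.
Unset Strict Implicit.
Unset Printing Implicit Defensive.

Local Open Scope classical_set_scope.
Local Open Scope ring_scope.

Definition dim_at_least (K : numFieldType) (X : normedModType K) (n : nat) : Prop :=
  exists e : 'I_n -> X, forall c : 'I_n -> K,
    \sum_(i < n) c i *: e i = 0 -> forall i, c i = 0.

Definition finite_dimensional (K : numFieldType) (X : normedModType K) : Prop :=
  exists (n : nat) (e : 'I_n -> X), forall x : X,
    exists c : 'I_n -> K, x = \sum_(i < n) c i *: e i.

Section Lattices.
Context {K : numFieldType} {X : normedModType K}.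
Implicit Types (M N : set X) (F L : set (set X)).

Definition is_subspace M : Prop := submod_closed (mem M) /\ closed M.

Definition sum_set M N : set X := [set x + y | x in M & y in N].

Definition join M N : set X := closure (sum_set M N).

(* The norm takes values in K (the complex numbers in the application), so the
   inequality already forces C to be real unless M is contained in {0}. *)
Definition bounded_on M (f : X -> X) : Prop :=
  exists C : K, forall x, M x -> `|f x| <= C * `|x|.

Definition bounded_operator (A : {linear X -> X}) : Prop := bounded_on setT A.

Definition Alg F : set {linear X -> X} :=
  [set A | bounded_operator A /\ forall M, F M -> A @` M `<=` M].

Definition Lat (T : set {linear X -> X}) : set (set X) :=
  [set M | is_subspace M /\ forall A, T A -> A @` M `<=` M].

(* [reflexive] is already taken by ssrbool, for relations. *)
Definition reflexive_lattice L : Prop := Lat (Alg L) = L.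

Definition double_triangle L : Prop :=
  exists K1 L1 M1 : set X,
    [/\ [/\ is_subspace K1, is_subspace L1 & is_subspace M1],
        uniq [:: [set 0]; K1; L1; M1; setT],
        [/\ K1 `&` L1 = [set 0], K1 `&` M1 = [set 0] & L1 `&` M1 = [set 0]],
        [/\ join K1 L1 = setT, join K1 M1 = setT & join L1 M1 = setT]
      & L = [set [set 0]; K1; L1; M1; setT]].

(* An operator M -> N is encoded by a function on all of X whose values outside
   M are never used. *)
Definition bounded_linear_on M N (U : X -> X) : Prop :=
  [/\ U @` M `<=` N,
      forall (a : K) x y, M x -> M y -> U (a *: x + y) = a *: U x + U y
    & bounded_on M U].

Definition invertible_on M N (U : X -> X) : Prop :=
  bounded_linear_on M N U /\
  exists V : X -> X, [/\ bounded_linear_on N M V,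
    forall x, M x -> V (U x) = x & forall y, N y -> U (V y) = y].

Definition graph_subspace M (U : X -> X) (w : K) : set X :=
  [set x + w *: U x | x in M].

Definition TU M0 Minf (U : X -> X) : set (set X) :=
  [set [set 0]; M0; graph_subspace M0 U 1; Minf; setT].

End Lattices.

(* Main.v *)
Require Import Defs.
From HB Require Import structures.
From mathcomp Require Import all_boot all_order all_algebra.
From mathcomp Require Import complex.
From mathcomp Require Import all_classical all_reals all_analysis.
From mathcomp Require Import ring lra.
Import Order.TTheory GRing.Theory Num.Theory.
Import numFieldNormedType.Exports.
Local Open Scope classical_set_scope.
Local Open Scope ring_scope.
Local Open Scope complex_scope.

(* In the coordinates [(x, y) |-> x + U y] of [X] on [M0 x M0], the operators of
   [Alg (TU M0 Minf U)] are the diagonal ones [(x, y) |-> (B x, B y)], hence they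
   leave every [graph_subspace M0 U w] invariant. Conversely, let [N] be
   invariant and consider the rank-one operators [B x = F x *: z]. If [(x, y)]
   is in [N] then [(F x *: z, F y *: z)] is in [N] for all [F] and [z], so [N]
   contains [{(a z, b z)}] for every [(a, b)] in a subspace [E] of the scalar
   plane, and as functionals separate points [N] is exactly the space attached
   to [E]: the lines give the [graph_subspace M0 U w] and [Minf].
   These operators are bounded because the projection onto [M0] along [Minf] is
   (Zabreiko's lemma, by a Baire category argument), and enough functionals [F]
   exist by the Hahn-Banach theorem.
   In finite dimension all linear subspaces are closed, so a double triangle
   [K, L, M] satisfies [X = K + M = L + M = K + L] algebraically, and [L] is the
   graph of an invertible operator from [K] to [M]. *)

(** * The norm as a real number, and subspaces in epsilon form *)

Section RealNorm.
Context {R : realType} {X : normedModType R[i]}.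
Implicit Types (x y z : X) (M N : set X).

(** The norm of [X] has values in [R[i]]; by [nrmE] its real part loses nothing, and it lives in
    [R], where suprema and linear arithmetic are available. *)
Definition nrm (x : X) : R := complex.Re `|x|.

Lemma nrmE x : `|x| = (nrm x)%:C.
Proof. by rewrite /nrm RRe_real// normr_real. Qed.

Lemma nrm_ge0 x : 0 <= nrm x.
Proof. by rewrite -ler0c -nrmE. Qed.

Lemma nrm_eq0 x : nrm x = 0 -> x = 0.
Proof. by move=> h; apply/normr0_eq0; rewrite nrmE h. Qed.

Lemma nrm0 : nrm 0 = 0.
Proof. by rewrite /nrm normr0. Qed.

Lemma nrmN x : nrm (- x) = nrm x.
Proof. by rewrite /nrm normrN. Qed.

Lemma nrm_distC x y : nrm (x - y) = nrm (y - x).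
Proof. by rewrite /nrm distrC. Qed.

Lemma ler_nrmD x y : nrm (x + y) <= nrm x + nrm y.
Proof. by rewrite -lecR rmorphD/= -!nrmE ler_normD. Qed.

Lemma ler_nrm_dist y x z : nrm (x - z) <= nrm (x - y) + nrm (y - z).
Proof. by apply: le_trans (ler_nrmD _ _); rewrite addrA subrK. Qed.

Lemma nrmZ (a : R[i]) x : nrm (a *: x) = complex.Re `|a| * nrm x.
Proof.
by apply: complexI; rewrite rmorphM/= -!nrmE normrZ; congr (_ * _).
Qed.

Lemma nrmZr (t : R) x : nrm (t%:C *: x) = `|t| * nrm x.
Proof. by rewrite nrmZ normc_def/= expr0n addr0 sqrtr_sqr. Qed.

Lemma Re_normrM (a b : R[i]) :
  complex.Re `|a * b| = complex.Re `|a| * complex.Re `|b|.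
Proof. by rewrite normrM !normc_def /= mulr0 subr0. Qed.

Lemma functional0 (F : X -> R[i]) :
  (forall (a : R[i]) y z, F (a *: y + z) = a * F y + F z) -> F 0 = 0.
Proof. by move=> FL; have := FL (-1) 0 0; rewrite scaler0 addr0 mulN1r addNr. Qed.

(** Trades neighbourhoods for real epsilons: a radius that is positive in [R[i]] is automatically
    real. *)
Lemma is_subspaceP M : is_subspace M <->
  [/\ M 0, forall (a : R[i]) x y, M x -> M y -> M (a *: x + y) &
    forall x, (forall e : R, 0 < e -> exists2 y, M y & nrm (x - y) < e) -> M x].
Proof.
split=> [[[M0 Ml] Mc]|[M0 Ml Mc]].
- split.
  + exact: set_mem.
  + by move=> a x y Mx My; apply/set_mem/Ml; exact: mem_set.
  + move=> x Mx; apply: Mc => B /nbhs_ballP[e /= e0 eB].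
    have e_real : e = (complex.Re e)%:C by rewrite RRe_real// gtr0_real.
    have [|y My xy] := Mx (complex.Re e); first by rewrite -ltcR -e_real.
    by exists y; split=> //; apply: eB; rewrite -ball_normE /= nrmE e_real ltcR.
- split.
  + split; first exact: mem_set.
    by move=> a x y /set_mem Mx /set_mem My; apply/mem_set/Ml.
  + move=> x clx; apply: Mc => e e0.
    have /clx[y [My xy]] : nbhs x (ball x e%:C).
      by apply: nbhsx_ballx; rewrite ltcR.
    by exists y => //; move: xy; rewrite -ball_normE /= nrmE ltcR.
Qed.

End RealNorm.

(** * Algebraic closure properties of a subspace *)

Section Subspaces.
Context {R : realType} {X : normedModType R[i]} (M : set X).
Hypothesis M_sub : is_subspace M.

Lemma subspace0 : M 0. Proof. by have /is_subspaceP[] := M_sub. Qed.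

Lemma subspaceL (a : R[i]) x y : M x -> M y -> M (a *: x + y).
Proof. by have /is_subspaceP[_ + _] := M_sub; apply. Qed.

Lemma subspaceZ (a : R[i]) x : M x -> M (a *: x).
Proof. by move=> Mx; rewrite -[_ *: _]addr0; apply: subspaceL => //; apply: subspace0. Qed.

Lemma subspaceD x y : M x -> M y -> M (x + y).
Proof. by move=> Mx My; rewrite -[x]scale1r; apply: subspaceL. Qed.

Lemma subspaceN x : M x -> M (- x).
Proof. by move=> Mx; rewrite -scaleN1r; apply: subspaceZ. Qed.

Lemma subspaceB x y : M x -> M y -> M (x - y).
Proof. by move=> Mx My; apply: subspaceD => //; apply: subspaceN. Qed.

Lemma subspace_closed x :
  (forall e : R, 0 < e -> exists2 y, M y & nrm (x - y) < e) -> M x.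
Proof. by have /is_subspaceP[_ _] := M_sub; apply. Qed.

End Subspaces.

(** * Geometrically convergent sequences *)

Lemma half_expn_lt {R : realType} (e C : R) : 0 < e -> exists n, C * 2^-1 ^+ n < e.
Proof.
move=> e0; have : (fun n => C * 2^-1 ^+ n) @ \oo --> C * 0.
  apply: cvgM; first exact: cvg_cst.
  by apply: cvg_expr; rewrite ger0_norm ?invr_ge0// invf_lt1// ltr1n.
rewrite mulr0 => /cvgr_lt /(_ _ e0)[n _ h].
by exists n; apply: h => /=.
Qed.

Section Complete.
Context {R : realType} {X : completeNormedModType R[i]}.

(** The increments from [n] on add up to at most the geometric tail [2 * C * 2^-n], and this bound
    passes to the limit. *)
Lemma geometric_cauchy_cvg (u : nat -> X) (C : R) :
  (forall n, nrm (u n.+1 - u n) <= C * 2^-1 ^+ n) ->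
  exists l, forall n, nrm (l - u n) <= 2 * C * 2^-1 ^+ n.
Proof.
move=> uC.
have C0 : 0 <= C by have := uC 0%N; rewrite expr0 mulr1; apply: le_trans (nrm_ge0 _).
(* The tail beyond [n + k] is subtracted so that the induction on [k] closes. *)
have dist n k : nrm (u (n + k)%N - u n) <= 2 * C * 2^-1 ^+ n - 2 * C * 2^-1 ^+ (n + k).
  elim: k => [|k IH]; first by rewrite addn0 !subrr nrm0.
  rewrite addnS; apply: le_trans (ler_nrm_dist (u (n + k)%N) _ _) _.
  have := uC (n + k)%N; rewrite exprSr; lra.
have h0 k : 0 <= 2 * C * 2^-1 ^+ k :> R by rewrite !mulr_ge0 ?exprn_ge0 ?invr_ge0.
have dist' n k : (n <= k)%N -> nrm (u k - u n) <= 2 * C * 2^-1 ^+ n.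
  move=> /subnKC <-; apply: le_trans (dist _ _) _; rewrite gerBl.
  exact: h0.
have /cauchy_cvg/cvg_ex[l ul] : cauchy (u @ \oo).
  apply: cauchy_exP => e e0.
  have e_real : e = (complex.Re e)%:C by rewrite RRe_real// gtr0_real.
  have e0' : 0 < complex.Re e by rewrite -ltcR -e_real.
  have [n un] := half_expn_lt (complex.Re e) (2 * C) e0'.
  exists (u n); exists n => //= k nk; rewrite -ball_normE /= nrmE e_real ltcR.
  by rewrite nrm_distC; apply: le_lt_trans un; apply: dist'.
exists l => n; apply/ler_addgt0Pr => e e0.
have /cvgrPdist_lt/(_ e%:C) := ul.
rewrite ltcR => /(_ e0)[k _ uk].
have := uk (maxn n k) (leq_maxr _ _); rewrite /= nrmE ltcR => lk.
have := dist' n _ (leq_maxl n k).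
have := ler_nrm_dist (u (maxn n k)) l (u n); lra.
Qed.

End Complete.

(** * Zabreiko's lemma on seminorms *)

Section Zabreiko.
Context {R : realType} {X : completeNormedModType R[i]} (p : X -> R).
Hypothesis pD : forall x y, p (x + y) <= p x + p y.
Hypothesis pZ : forall (t : R) x, p (t%:C *: x) = `|t| * p x.

Let pN x : p (- x) = p x.
Proof.
rewrite -scaleN1r -[in LHS](rmorph1 (real_complex R)) -rmorphN /=.
by rewrite [LHS](pZ (-1)) normrN1 mul1r.
Qed.

(** Baire category by nested balls: if no sublevel set of [p] were dense in a ball, closed balls
    with radii at most [2^-n] could be nested, the one of index [n.+1] avoiding the sublevel set of
    [n]; at their common point [p] would exceed every integer. *)
Lemma sublevel_somewhere_dense : exists (n : nat) (c : X) (r : R), 0 < r /\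
  forall z, nrm (z - c) <= r -> forall e, 0 < e ->
  exists2 a, p a <= n%:R & nrm (z - a) < e.
Proof.
apply: contrapT => nowhere.
(* Positivity of the radius is a premise inside the existential, so that [choice] yields a total
   function. *)
have step (q : nat * (X * R)) : exists q' : X * R, 0 < q.2.2 ->
    [/\ nrm (q'.1 - q.2.1) <= q.2.2 / 2, 0 < q'.2, q'.2 <= q.2.2 / 2 &
      forall a, nrm (a - q'.1) <= q'.2 -> q.1%:R < p a].
  case: q => n [c r] /=; have [r0|r0] := ltP 0 r; last first.
    by exists (c, r) => /=; rewrite ltNge r0.
  apply: contrapT => H; apply: nowhere; exists n, c, (r / 2); split.
    by rewrite divr_gt0.
  move=> z zc e e0; apply: contrapT => nz; apply: H.
  (* The bound [e / 2] turns the strict inequality [< e] into a closed ball free of sublevel points;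
     [r / 2] keeps the balls nested. *)
  exists (z, Num.min (e / 2) (r / 2)) => _ /=; split => //.
  - by rewrite lt_min !divr_gt0.
  - by rewrite ge_min lexx orbT.
  - move=> a; rewrite le_min => /andP[ae _]; rewrite ltNge; apply/negP => pa.
    apply: nz; exists a => //; rewrite nrm_distC; apply: le_lt_trans ae _.
    by rewrite ltr_pdivrMr// ltr_pMr// ltr1n.
have [f fP] := choice step.
pose fix s n := if n is m.+1 then f (m, s m) else (0 : X, 1 : R).
have s_gt0 n : 0 < (s n).2.
  elim: n => [|n IH] /=; first exact: ltr01.
  by have [] := fP (n, s n) IH.
have sP n := fP (n, s n) (s_gt0 n).
have s_le n : (s n).2 <= 2^-1 ^+ n.
  elim: n => [|n IH]; first by rewrite expr0.
  have [_ _ /= h _] := sP n; rewrite exprSr; apply: le_trans h _.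
  by rewrite ler_pM2r ?invr_gt0.
have [l lP] : exists l, forall n, nrm (l - (s n).1) <= 2 * 2^-1 * 2^-1 ^+ n.
  apply: geometric_cauchy_cvg => n; have [/= h _ _ _] := sP n.
  apply: le_trans h _; rewrite mulrC ler_pM2l ?invr_gt0//; exact: s_le.
have dist n k : nrm ((s (n + k)%N).1 - (s n).1) <= (s n).2.
  (* The centres move by at most the loss in radius, a bound that adds up along the sequence. *)
  suff : nrm ((s (n + k)%N).1 - (s n).1) <= (s n).2 - (s (n + k)%N).2.
    by move=> /le_trans; apply; rewrite gerBl ltW.
  elim: k => [|k IH]; first by rewrite addn0 !subrr nrm0.
  rewrite addnS; apply: le_trans (ler_nrm_dist (s (n + k)%N).1 _ _) _.
  have [/= h1 _ h2 _] := sP (n + k)%N; move: IH h1 h2 => /=; lra.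
have l_in n : nrm (l - (s n).1) <= (s n).2.
  apply/ler_addgt0Pr => e e0.
  have [k ke] := half_expn_lt e (2 * 2^-1) e0.
  have hk : (2 * 2^-1) * 2^-1 ^+ (n + k) <= (2 * 2^-1) * 2^-1 ^+ k :> R.
    rewrite ler_pM2l ?mulr_gt0 ?invr_gt0// ler_wiXn2l ?invr_ge0 ?leq_addl//.
    by rewrite invf_le1// ler1n.
  have := lP (n + k)%N; have := dist n k.
  have := ler_nrm_dist (s (n + k)%N).1 l (s n).1; lra.
have pl n : n%:R < p l by have [_ _ _] := sP n; apply; exact: l_in n.+1.
have := pl (Num.truncn (p l)).+1.
by rewrite ltNge ltW// Num.Theory.truncnS_gt.
Qed.

(** Stands for countable subadditivity, along geometrically convergent sequences; [2 * C] is the sum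
    of the series [C * 2^-n]. *)
Hypothesis p_limit : forall (u : nat -> X) (l : X) (C D : R),
  (forall n, p (u n.+1 - u n) <= C * 2^-1 ^+ n) ->
  (forall n, nrm (l - u n) <= D * 2^-1 ^+ n) -> p (l - u 0%N) <= 2 * C.

(** A vector of norm at most [r] is approximated within the sublevel set, then its remainder at half
    the scale, and so on. The [k]-th correction has [p]-value at most [N * 2^-k], so [p_limit]
    bounds [p] by [2 * N] on this ball, and homogeneity extends the bound. *)
Lemma Zabreiko : exists C : R, forall x, p x <= C * nrm x.
Proof.
have [n [c [r [r0 dense]]]] := sublevel_somewhere_dense.
(* An approximation of [z] is the difference of one of [c + z] and one of [c], so the level
   doubles. *)
pose N : R := n%:R + n%:R.
have dense0 z e : nrm z <= r -> 0 < e -> exists2 a, p a <= N & nrm (z - a) < e.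
  move=> zr e0; have e20 : 0 < e / 2 by rewrite divr_gt0.
  have [|a1 pa1 za1] := dense (c + z) _ _ e20; first by rewrite addrC addKr.
  have [|a2 pa2 ca2] := dense c _ _ e20; first by rewrite subrr nrm0 ltW.
  exists (a1 - a2).
    by apply: le_trans (pD _ _) _; rewrite pN; exact: lerD.
  have -> : z - (a1 - a2) = (c + z - a1) - (c - a2).
    by rewrite -[c + z - a1]addrA !opprB [a2 - c]addrC addrACA subrr add0r addrA addrAC.
  apply: le_lt_trans (ler_nrmD _ _) _; rewrite nrmN.
  have -> : e = e / 2 + e / 2 by lra.
  exact: ltrD.
(* The pair [q] holds a scale and a remainder; the tolerance [r / 2] at scale 1 halves the bound on
   the remainder. The value [0] is a default where the premises fail. *)
have approx (q : R * X) : exists a, 0 < q.1 -> nrm q.2 <= r * q.1 ->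
    p a <= N * q.1 /\ nrm (q.2 - a) <= r * (q.1 / 2).
  case: q => t z /=; have [t0|] := ltP 0 t; last by exists 0.
  have [zr|] := leP (nrm z) (r * t); last by exists 0.
  have tK x : t%:C *: (t^-1%:C *: x) = x :> X.
    by rewrite scalerA -rmorphM/= divff ?scale1r// gt_eqF.
  have [||a pa za] := dense0 (t^-1%:C *: z) (r / 2).
  - by rewrite nrmZr gtr0_norm ?invr_gt0// mulrC ler_pdivrMr.
  - by rewrite divr_gt0.
  exists (t%:C *: a) => _ _; split.
    by rewrite pZ gtr0_norm// mulrC ler_pM2r.
  rewrite -[z]tK -scalerBr nrmZr gtr0_norm//.
  by rewrite (mulrCA r) ler_pM2l// ltW.
have [g gP] := choice approx.
have small z : nrm z <= r -> p z <= 2 * N.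
  move=> zr.
  pose fix u k := if k is m.+1 then u m + g (2^-1 ^+ m, z - u m) else 0 : X.
  have h0 k : 0 < 2^-1 ^+ k :> R by rewrite exprn_gt0 ?invr_gt0.
  have uz k : nrm (z - u k) <= r * 2^-1 ^+ k.
    elim: k => [|k IH] /=; first by rewrite subr0 expr0 mulr1.
    have [_] := gP (2^-1 ^+ k, z - u k) (h0 k) IH.
    by rewrite /= opprD addrA exprSr.
  rewrite -[z]subr0 -/(u 0%N); apply: (p_limit _ _ _ r) => // k /=.
  rewrite addrC addKr.
  by have [] := gP (2^-1 ^+ k, z - u k) (h0 k) (uz k).
exists (2 * N / r) => x.
have [x0|x0] := eqVneq (nrm x) 0.
  by rewrite (nrm_eq0 x x0) nrm0 mulr0 -(scale0r 0) (pZ 0) normr0 mul0r.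
have x_gt0 : 0 < nrm x by rewrite lt_neqAle eq_sym x0 nrm_ge0.
have := small ((r / nrm x)%:C *: x).
have rx : 0 < r / nrm x by rewrite divr_gt0.
rewrite nrmZr pZ gtr0_norm// divfK// => /(_ (lexx _)).
by rewrite -ler_pdivlMl// invf_div mulrC -mulrA (mulrC _^-1) mulrA => /le_trans; apply.
Qed.

End Zabreiko.

(** * The Hahn-Banach theorem, first over the reals *)

Section HahnBanach.
Context {R : realType} {X : normedModType R[i]} (x : X).
Implicit Types (G : set (X * R)) (y z : X) (r s t : R).

(* The graph of a real-linear functional dominated by the norm and mapping [x]
   to its norm; the empty graph is allowed as well, so that this condition is
   stable under unions of chains. *)
Definition dominated_graph G :=
  (forall y r z s (a b t : R), G (y, r) -> G (z, s) ->
    G (a%:C *: y + b%:C *: z + t%:C *: x, a * r + b * s + t * nrm x)) /\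
  (forall y r, G (y, r) -> r <= nrm y).

Let line : set (X * R) := [set (t%:C *: x, t * nrm x) | t in setT].

Let dominated_line : dominated_graph line.
Proof.
split=> [_ _ _ _ a b t [u _ [<- <-]] [v _ [<- <-]]|_ _ [t _ [<- <-]]].
  exists (a * u + b * v + t) => //; congr pair; last by ring.
  by rewrite !scalerA -!scalerDl !rmorphD !rmorphM.
by rewrite nrmZr ler_wpM2r ?nrm_ge0 ?ler_norm.
Qed.

(** The difference of two values over [y] is a value over [0], hence at most [nrm 0]. *)
Let dominated_functional G y r s : dominated_graph G ->
  G (y, r) -> G (y, s) -> r = s.
Proof.
move=> [Glin Gdom].
suff le r' s' : G (y, r') -> G (y, s') -> r' <= s'.
  by move=> Gr Gs; apply/eqP; rewrite eq_le !le.
move=> Gr Gs; rewrite -subr_le0.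
have := Gdom _ _ (Glin y r' y s' 1 (-1) 0 Gr Gs).
rewrite rmorphN rmorph1 !scale1r scaleN1r subrr scale0r addr0 nrm0.
by rewrite mul1r mulN1r mul0r addr0.
Qed.

(** The value [c] at [y0] must lie above every [r - nrm (y - y0)] and below every
    [nrm (z + y0) - s]. The triangle inequality separates the two families, so the supremum of the
    first serves. *)
Let dominated_extend G y0 : dominated_graph G -> G !=set0 ->
  exists G', [/\ dominated_graph G', G `<=` G' & exists r, G' (y0, r)].
Proof.
move=> [Glin Gdom] [[w q] Gw].
have G0 : G (0, 0).
  have := Glin w q w q 0 0 0 Gw Gw.
  by rewrite !scale0r !mul0r !addr0.
have GZ t y r : G (y, r) -> G (t%:C *: y, t * r).
  move=> Gy; have := Glin y r 0 0 t 0 0 Gy G0.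
  by rewrite !scale0r !mul0r !addr0.
have GD y r z s : G (y, r) -> G (z, s) -> G (y + z, r + s).
  move=> Gy Gz; have := Glin y r z s 1 1 0 Gy Gz.
  by rewrite !scale1r !mul1r scale0r mul0r !addr0.
pose S := [set q.2 - nrm (q.1 - y0) | q in G].
have S_ub z s : G (z, s) -> ubound S (nrm (z + y0) - s).
  move=> Gz _ [[y r] Gy <-] /=.
  have := Gdom _ _ (GD _ _ _ _ Gy Gz).
  have := ler_nrmD (y - y0) (z + y0).
  by rewrite addrACA addNr addr0; lra.
have S0 : S !=set0 by exists (0 - nrm (0 - y0)); exists (0, 0).
have hsS : has_sup S by split=> //; exists (nrm (0 + y0) - 0); exact: S_ub.
pose c := sup S.
have c_ge y r : G (y, r) -> r - nrm (y - y0) <= c.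
  by move=> Gy; apply: ub_le_sup; [case: hsS | exists (y, r)].
have c_le z s : G (z, s) -> c <= nrm (z + y0) - s.
  by move=> Gz; apply: ge_sup => //; exact: S_ub.
exists [set (q.1.1 + q.2%:C *: y0, q.1.2 + q.2 * c) | q in G `*` setT].
split; last 2 first.
- move=> [y r] Gy; exists ((y, r), 0) => //=.
  by rewrite scale0r mul0r !addr0.
- exists c; exists ((0, 0), 1) => //=.
  by rewrite scale1r mul1r !add0r.
split.
- move=> _ _ _ _ a b t [[[y r] u] [/= Gy _] [<- <-]] [[[z s] v] [/= Gz _] [<- <-]].
  exists ((a%:C *: y + b%:C *: z + t%:C *: x, a * r + b * s + t * nrm x), a * u + b * v).
    by split=> //=; exact: Glin.
  congr pair => /=; last by ring.
  rewrite rmorphD !rmorphM /= !scalerDr scalerDl !scalerA.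
  by rewrite [LHS]addrAC; congr (_ + _); rewrite addrACA.
- move=> _ _ [[[y r] t] [/= Gy _] [<- <-]].
  have inv u : 0 < u -> u%:C *: (u^-1%:C *: y) = y :> X.
    by move=> u0; rewrite scalerA -rmorphM/= divff ?scale1r// gt_eqF.
  (* After division by the absolute value of [t], its sign decides which of the two bounds on [c]
     applies. *)
  have [t0|t0|->] := ltgtP t 0; last first.
  + by rewrite scale0r mul0r !addr0; exact: Gdom.
  + have := c_le _ _ (GZ t^-1 _ _ Gy).
    rewrite -(ler_pM2l t0) mulrBr mulrA divff ?gt_eqF// mul1r.
    have -> : nrm (y + t%:C *: y0) = t * nrm (t^-1%:C *: y + y0).
      by rewrite -[X in X * nrm _](gtr0_norm t0) -nrmZr scalerDr inv.
    lra.
  + have nt0 : 0 < - t by rewrite oppr_gt0.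
    have := c_ge _ _ (GZ (- t)^-1 _ _ Gy).
    rewrite -(ler_pM2l nt0) mulrBr mulrA divff ?gt_eqF// mul1r.
    have -> : nrm (y + t%:C *: y0) = - t * nrm ((- t)^-1%:C *: y - y0).
      rewrite -[X in X * nrm _](gtr0_norm nt0) -nrmZr scalerBr inv//.
      by rewrite rmorphN scaleNr opprK.
    lra.
Qed.

(** A maximal dominated graph, given by Zorn's lemma, is total because of the one-step extension. *)
Lemma real_norming_functional : exists g : X -> R,
  [/\ forall (a b : R) y z, g (a%:C *: y + b%:C *: z) = a * g y + b * g z,
      forall y, g y <= nrm y & g x = nrm x].
Proof.
have [F FP Ftot|G [Ggood Gmax]] := @Zorn_bigcup _ dominated_graph.
  split=> [y r z s a b t [G FG Gy] [H FH Hz]|y r [G FG Gy]].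
    have [GH|HG] := Ftot _ _ FG FH.
    - by exists H => //; have [+ _] := FP _ FH; apply => //; exact: GH.
    - by exists G => //; have [+ _] := FP _ FG; apply => //; exact: HG.
  by have [_] := FP _ FG; apply.
(* The empty graph is not maximal, since [line] extends it. *)
have Gne : G !=set0.
  apply/set0P/eqP => G0; apply: (Gmax line) => //; rewrite G0; split=> //.
  by move=> /(_ (0%:C *: x, 0 * nrm x)); apply; exists 0.
have Gtot y : exists r, G (y, r).
  have [G' [G'good GG' [r G'y]]] := dominated_extend _ y Ggood Gne.
  exists r; apply: contrapT => nGy; apply: (Gmax G') => //; split=> //.
  by move=> /(_ _ G'y).
have [g gP] := choice Gtot.
have [Glin Gdom] := Ggood.
exists g; split.
- move=> a b y z; apply: (dominated_functional G _ _ _ Ggood (gP _)).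
  have := Glin _ _ _ _ a b 0 (gP y) (gP z).
  by rewrite scale0r mul0r !addr0.
- by move=> y; exact: Gdom.
(* With coefficients 0, 0, 1 the linearity clause puts [(x, nrm x)] into [G]. *)
- apply: (dominated_functional G _ _ _ Ggood (gP _)).
  have := Glin _ _ _ _ 0 0 1 (gP x) (gP x).
  by rewrite !scale0r !mul0r scale1r mul1r !add0r.
Qed.

(* A real-linear [g] is the real part of the complex-linear map
   [y |-> g y - i g (i y)]. *)
Lemma separating_functional : x <> 0 -> exists F : X -> R[i],
  [/\ forall (a : R[i]) y z, F (a *: y + z) = a * F y + F z,
      exists2 C : R, 0 <= C & forall y, complex.Re `|F y| <= C * nrm y
    & F x <> 0].
Proof.
move=> x0; have [g [glin gdom gx]] := real_norming_functional.
have gabs y : `|g y| <= nrm y.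
  rewrite ler_norml gdom andbT lerNl.
  have := glin (-1) 0 y y; rewrite scale0r mul0r !addr0 mulN1r => <-.
  by apply: le_trans (gdom _) _; rewrite nrmZr normrN1 mul1r.
have iE (a : R[i]) : a = complex.Re a +i* complex.Im a by case: a.
exists (fun y => g y +i* - g ('i *: y)); split.
- move=> a y z.
  have -> : a *: y + z = 1%:C *: ((complex.Re a)%:C *: y +
      (complex.Im a)%:C *: ('i *: y)) + 1%:C *: z.
    by rewrite !scale1r scalerA -scalerDl mulrC -complexE.
  rewrite glin glin; set w := 'i *: (_ + _).
  have -> : w = 1%:C *: ((complex.Re a)%:C *: ('i *: y) +
      (- complex.Im a)%:C *: y) + 1%:C *: ('i *: z).
    rewrite /w !scale1r scalerDr scalerDr !scalerA !(mulrC 'i) -mulrA.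
    by rewrite -expr2 sqr_i mulrN1 rmorphN.
  rewrite glin glin; case: a {w} => u v /=; simpc.
  by congr (_ +i* _); ring.
(* Each part of [F y] is at most [nrm y] in absolute value, as multiplication by ['i] preserves the
   norm. *)
- exists 2 => // y.
  have -> : g y +i* - g ('i *: y) = (g y)%:C - 'i * (g ('i *: y))%:C.
    by simpc.
  rewrite -lecR RRe_real ?normr_real//.
  apply: le_trans (ler_normB _ _) _; rewrite normrM.
  have ni : `|'i : R[i]| = 1 by rewrite normc_def/= expr0n add0r expr1n sqrtr1.
  have nr (r : R) : `|r%:C| = `|r|%:C.
    by rewrite normc_def/= expr0n addr0 sqrtr_sqr.
  rewrite ni mul1r !nr -rmorphD/= lecR.
  have := gabs y; have := gabs ('i *: y).
  by rewrite nrmZ ni mul1r; lra.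
- move=> /(congr1 (@complex.Re R)) /=; rewrite gx => /nrm_eq0; exact: x0.
Qed.

End HahnBanach.

(** * Boundedness of projections along closed complements *)

Section Complements.
Context {R : realType} {X : completeNormedModType R[i]}.
Implicit Types (M N : set X) (x y z : X).

Lemma direct_sum_unique M N x y x' y' : is_subspace M -> is_subspace N ->
  M `&` N = [set 0] -> M x -> N y -> M x' -> N y' -> x + y = x' + y' ->
  x = x' /\ y = y'.
Proof.
move=> sM sN MN Mx Ny Mx' Ny' e.
have e' : x - x' = y' - y.
  by apply/eqP; rewrite subr_eq addrAC eq_sym subr_eq addrC -e addrC.
have : (M `&` N) (x - x').
  by split; [exact: subspaceB | rewrite e'; exact: subspaceB].
rewrite MN /= => xx'; split; apply/eqP; first by rewrite -subr_eq0 xx'.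
by rewrite eq_sym -subr_eq0 -e' xx'.
Qed.

(** Zabreiko's lemma is applied to [nrm (P z)]. If [u n] tends to [l] and [P (u n)] to [m], then
    closedness puts [m] in [M] and [l - m] in [N], so [m = P l]. *)
Lemma complement_projection M N : is_subspace M -> is_subspace N ->
  M `&` N = [set 0] -> sum_set M N = setT ->
  exists P : X -> X,
    [/\ forall x, M (P x), forall x, N (x - P x),
        forall (a : R[i]) x y, P (a *: x + y) = a *: P x + P y &
        exists C : R, forall x, nrm (P x) <= C * nrm x].
Proof.
move=> sM sN MN MNT.
have dec z : exists x, M x /\ N (z - x).
  have : sum_set M N z by rewrite MNT.
  by move=> [x Mx [y Ny <-]]; exists x; rewrite addrAC subrr add0r.
have [P PP] := choice dec.
have MP z : M (P z) by case: (PP z).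
have NP z : N (z - P z) by case: (PP z).
have PE x y : M x -> N (y - x) -> P y = x.
  move=> Mx Nyx; have e : P y + (y - P y) = x + (y - x) by rewrite !subrKC.
  by have [] := direct_sum_unique _ _ _ _ _ _ sM sN MN (MP y) (NP y) Mx Nyx e.
have PL (a : R[i]) x y : P (a *: x + y) = a *: P x + P y.
  apply: PE; first exact: subspaceL.
  rewrite opprD addrACA -scalerBr; exact: subspaceL.
have PB x y : P (x - y) = P x - P y.
  by rewrite addrC -scaleN1r PL scaleN1r addrC.
exists P; split=> //.
apply: (Zabreiko (fun z => nrm (P z))) => /=.
- move=> x y; rewrite -{1}[x]scale1r PL scale1r; exact: ler_nrmD.
- move=> t x; have P0 : P 0 = 0 by rewrite -(subrr 0) PB !subrr.
  by rewrite -[_ *: _]addr0 PL P0 addr0 nrmZr.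
- move=> u l C D uC lD.
  have [|m mP] := geometric_cauchy_cvg (P \o u) C.
    by move=> n; rewrite /= -PB.
  have Mm : M m.
    apply: (subspace_closed _ sM) => e e0.
    have [n ne] := half_expn_lt e (2 * C) e0.
    by exists (P (u n)) => //; exact: le_lt_trans (mP n) ne.
  have Nlm : N (l - m).
    apply: (subspace_closed _ sN) => e e0.
    have [n ne] := half_expn_lt e (D + 2 * C) e0.
    exists (u n - P (u n)) => //.
    have -> : l - m - (u n - P (u n)) = (l - u n) - (m - P (u n)).
      by rewrite !opprD addrACA.
    apply: le_lt_trans (ler_nrmD _ _) _; rewrite nrmN.
    have := mP n; have := lD n; move: ne; rewrite /= mulrDl; lra.
  rewrite PB (PE _ _ Mm Nlm).
  by have := mP 0%N; rewrite expr0 mulr1.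
Qed.

Lemma bounded_onP M (f : X -> X) : bounded_on M f <->
  exists2 C : R, 0 <= C & forall x, M x -> nrm (f x) <= C * nrm x.
Proof.
split=> [[C fC]|[C C0 fC]].
- exists (complex.Re `|C|) => [|x Mx].
    by rewrite -ler0c RRe_real// normr_real.
  rewrite -nrmZ -lecR -!nrmE normrZ -[`|x|]normr_id -normrM -[`|f x|]normr_id.
  have h := fC x Mx; have h0 := le_trans (normr_ge0 _) h.
  by rewrite !ger0_norm ?normr_ge0//; exact: h.
- exists C%:C => x Mx; rewrite !nrmE -rmorphM/= lecR; exact: fC.
Qed.

End Complements.

(** * The trivial subspaces *)

Section TrivialSubspaces.
Context {R : realType} {X : normedModType R[i]}.

Lemma is_subspace_set0 : is_subspace [set 0 : X].
Proof.
apply/is_subspaceP; split=> //=.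
  by move=> a x y -> ->; rewrite scaler0 addr0.
move=> x xlim; apply/nrm_eq0/eqP; rewrite eq_le nrm_ge0 andbT.
apply/ler_addgt0Pr => e /xlim[_ -> xe].
by rewrite add0r -[x]subr0 ltW.
Qed.

Lemma is_subspace_setT : is_subspace [set: X].
Proof. exact/is_subspaceP. Qed.

Lemma sub_Lat_Alg (L : set (set X)) M : is_subspace M -> L M -> Lat (Alg L) M.
Proof. by move=> sM LM; split=> // A [_]; exact. Qed.

End TrivialSubspaces.

(** * Computation of [Lat (Alg (TU M0 Minf U))] *)

Section GraphLattice.
Context {R : realType} {X : completeNormedModType R[i]}.
Variables (M0 Minf : set X) (U : X -> X).
Hypotheses (sM0 : is_subspace M0) (sMinf : is_subspace Minf).
Hypotheses (M0_cap : M0 `&` Minf = [set 0]) (M0_sum : sum_set M0 Minf = setT).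
Hypothesis invU : invertible_on M0 Minf U.

Let UM x : M0 x -> Minf (U x).
Proof. by move=> M0x; have [[UM _ _] _] := invU; apply: UM; exists x. Qed.

Let UL (a : R[i]) x y : M0 x -> M0 y -> U (a *: x + y) = a *: U x + U y.
Proof. by have [[_ UL _] _] := invU; exact: UL. Qed.

Let U_inj x y : M0 x -> M0 y -> U x = U y -> x = y.
Proof.
have [_ [V [_ VU _]]] := invU.
by move=> Mx My e; rewrite -(VU x Mx) e VU.
Qed.

Let U_surj y : Minf y -> exists2 x, M0 x & U x = y.
Proof.
have [_ [V [[VM _ _] _ UV]]] := invU.
by move=> My; exists (V y); [apply: VM; exists y | exact: UV].
Qed.

Let U0 : U 0 = 0.
Proof.
have M00 := subspace0 _ sM0.
have := UL 1 0 0 M00 M00; rewrite scaler0 addr0 scale1r => h.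
by apply: (addrI (U 0)); rewrite -h addr0.
Qed.

Let UZ (a : R[i]) x : M0 x -> U (a *: x) = a *: U x.
Proof.
by move=> Mx; rewrite -[a *: x]addr0 UL ?U0 ?addr0//; exact: subspace0.
Qed.

Let decomp v : exists x y, [/\ M0 x, M0 y & v = x + U y].
Proof.
have : sum_set M0 Minf v by rewrite M0_sum.
move=> [x Mx [z Mz <-]]; have [y My yz] := U_surj _ Mz.
by exists x, y; rewrite yz.
Qed.

Let coordinates_unique x y x' y' : M0 x -> M0 y -> M0 x' -> M0 y' ->
  x + U y = x' + U y' -> x = x' /\ y = y'.
Proof.
move=> Mx My Mx' My' /(direct_sum_unique _ _ _ _ _ _ sM0 sMinf M0_cap Mx (UM _ My) Mx' (UM _ My')).
by move=> [-> /U_inj ->].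
Qed.

(** [P] projects onto [M0], and [Q] pulls the [Minf] component back by the inverse [V] of [U]; they
    are bounded because the projection and [V] are. *)
Let coordinates : exists P Q : X -> X,
  [/\ forall v, M0 (P v), forall v, M0 (Q v), forall v, v = P v + U (Q v),
      forall a u v, P (a *: u + v) = a *: P u + P v /\
                    Q (a *: u + v) = a *: Q u + Q v
    & exists2 C : R, 0 <= C & forall v, nrm (P v) <= C * nrm v /\ nrm (Q v) <= C * nrm v].
Proof.
have [P [MP NP PL [C PC]]] := complement_projection _ _ sM0 sMinf M0_cap M0_sum.
have [_ [V [[VM VL /bounded_onP[D D0 VD]] _ UV]]] := invU.
have MV y : Minf y -> M0 (V y) by move=> My; apply: VM; exists y.
exists P, (fun v => V (v - P v)); split=> //.
- by move=> v; exact: MV.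
- by move=> v; rewrite UV// subrKC.
- move=> a u v; split=> //.
  by rewrite PL opprD addrACA -scalerBr VL.
- have PC' v : nrm (P v) <= `|C| * nrm v.
    by apply: le_trans (PC v) _; rewrite ler_wpM2r ?nrm_ge0 ?ler_norm.
  exists (`|C| + D * (1 + `|C|)).
    by rewrite addr_ge0// mulr_ge0// addr_ge0.
  move=> v; split.
    apply: le_trans (PC' v) _; rewrite ler_wpM2r ?nrm_ge0// lerDl.
    by rewrite mulr_ge0// addr_ge0.
  apply: le_trans (VD _ (NP v)) _; rewrite mulrDl.
  apply: (@le_trans _ _ (D * (1 + `|C|) * nrm v)); last first.
    by rewrite lerDr mulr_ge0 ?nrm_ge0.
  rewrite -mulrA ler_wpM2l//; apply: le_trans (ler_nrmD _ _) _.
  by rewrite nrmN mulrDl mul1r lerD2l.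
Qed.

(* In the coordinates of [X] on [M0 x M0], [A] is the operator [v |-> F v *: z]
   acting diagonally. *)
Lemma Alg_TU_rank_one (F : X -> R[i]) z :
  (forall (a : R[i]) u v, F (a *: u + v) = a * F u + F v) ->
  (exists2 C : R, 0 <= C & forall v, complex.Re `|F v| <= C * nrm v) -> M0 z ->
  exists2 A, Alg (TU M0 Minf U) A & forall x y, M0 x -> M0 y ->
    A (x + U y) = F x *: z + F y *: U z.
Proof.
move=> FL [C C0 FC] Mz.
have [P [Q [MP MQ PQ PQL [D D0 PD]]]] := coordinates.
pose f v := F (P v) *: z + F (Q v) *: U z.
have fL : linear f.
  move=> a u v; rewrite /f; have [-> ->] := PQL a u v.
  by rewrite !FL !scalerDl scalerDr !scalerA addrACA.
have [A Af] : exists A : {linear X -> X}, forall v, A v = f v.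
  pose A : {linear X -> X} := HB.pack f (GRing.isLinear.Build _ _ _ _ _ fL).
  by exists A.
have AE x y : M0 x -> M0 y -> A (x + U y) = F x *: z + F y *: U z.
  move=> Mx My; rewrite Af /f.
  by have [-> ->] := coordinates_unique _ _ _ _ (MP _) (MQ _) Mx My (esym (PQ (x + U y))).
have F0 := functional0 F FL.
have M00 := subspace0 _ sM0.
exists A => //; split.
- apply/bounded_onP; exists (C * D * nrm z + C * D * nrm (U z)).
    by rewrite addr_ge0// !mulr_ge0// nrm_ge0.
  move=> v _; rewrite Af /f; apply: le_trans (ler_nrmD _ _) _.
  rewrite !nrmZ [leRHS]mulrDl; have [Pv Qv] := PD v.
  have bd u : nrm u <= D * nrm v -> complex.Re `|F u| <= C * D * nrm v.
    move=> uv; apply: le_trans (FC u) _; rewrite -mulrA ler_wpM2l//.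
  by apply: lerD; rewrite mulrAC ler_wpM2r ?nrm_ge0//; apply: bd.
- move=> _ [[[[->|->]|->]|->]|->] _ [v + <-] //=.
  + by move=> ->; rewrite linear0.
  + move=> Mv; rewrite -[v]addr0 -U0 (AE _ _ Mv M00) F0 scale0r addr0.
    exact: subspaceZ.
  + move=> [x Mx <-]; rewrite scale1r AE// -scalerDr.
    exists (F x *: z); first exact: subspaceZ.
    by rewrite UZ// scale1r scalerDr.
  + move=> /U_surj[y My <-]; rewrite -[U y]add0r AE// F0 scale0r add0r.
    by apply: subspaceZ => //; exact: UM.
Qed.

(** The graph is the kernel of the bounded operator sending [v] to [Q v - w *: P v]. *)
Lemma is_subspace_graph w : is_subspace (graph_subspace M0 U w).
Proof.
have [P [Q [MP MQ PQ PQL [D D0 PD]]]] := coordinates.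
have M00 := subspace0 _ sM0.
apply/is_subspaceP; split.
- by exists 0 => //; rewrite U0 scaler0 addr0.
- move=> a _ _ [x Mx <-] [y My <-]; exists (a *: x + y); first exact: subspaceL.
  by rewrite UL// !scalerDr !scalerA (mulrC w) addrACA.
- move=> v vlim; suff h : Q v = w *: P v.
    by exists (P v) => //; rewrite -UZ// -h.
  apply/subr0_eq/nrm_eq0/eqP; rewrite eq_le nrm_ge0 andbT.
  apply/ler_addgt0Pr => e e0; rewrite add0r.
  (* A bound for that operator; [K + 1] is used as divisor because [K] may be zero. *)
  pose K := D + complex.Re `|w| * D.
  have w0 : 0 <= complex.Re `|w| by rewrite -ler0c RRe_real ?normr_real.
  have K0 : 0 <= K by rewrite addr_ge0// mulr_ge0.
  have e0' : 0 < e / (K + 1) by rewrite divr_gt0// ltr_wpDl.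
  have [_ [x Mx <-] vx] := vlim _ e0'.
  set u := x + _ in vx.
  have [Pu Qu] : P u = x /\ Q u = w *: x.
    apply: coordinates_unique => //; first exact: subspaceZ.
    by rewrite -PQ UZ.
  have -> : Q v - w *: P v = Q (v - u) - w *: P (v - u).
    rewrite [v - u]addrC -[- u]scaleN1r; have [-> ->] := PQL (-1) u v.
    rewrite Pu Qu !scaleN1r scalerDr scalerN opprD opprK addrACA.
    by rewrite addNr add0r.
  have [Pvu Qvu] := PD (v - u).
  apply: le_trans (ler_nrmD _ _) _; rewrite nrmN nrmZ.
  apply: (@le_trans _ _ (K * nrm (v - u))).
    rewrite mulrDl; apply: lerD => //.
    by rewrite -mulrA ler_wpM2l.
  move: vx; rewrite ltr_pdivlMr ?ltr_wpDl// => /ltW; apply: le_trans.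
  by rewrite mulrDr mulr1 mulrC lerDl nrm_ge0.
Qed.

(** Invariance of [M0], [Minf] and the graph for [1] forces [A (U x) = U (A x)] on [M0], by
    uniqueness of the decomposition; hence every graph is preserved. *)
Lemma Lat_Alg_graph w : Lat (Alg (TU M0 Minf U)) (graph_subspace M0 U w).
Proof.
split; first exact: is_subspace_graph.
move=> A [_ AT] _ [_ [x Mx <-] <-].
have MA : M0 (A x) by apply: (AT M0); [do 3 left; right | exists x].
have MAU : Minf (A (U x)).
  by apply: (AT Minf); [left; right | exists (U x) => //; exact: UM].
have [y My yE] : graph_subspace M0 U 1 (A (x + 1 *: U x)).
  apply: (AT (graph_subspace M0 U 1)); first by do 2 left; right.
  by exists (x + 1 *: U x) => //; exists x.
move: yE; rewrite linearD !scale1r.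
move=> /(direct_sum_unique _ _ _ _ _ _ sM0 sMinf M0_cap My (UM _ My) MA MAU)[yA AUx].
by exists y => //; rewrite linearD linearZ /= -yA -AUx.
Qed.

(** Case analysis on the pairs with [E a b]: two independent ones force [N = setT]; otherwise all
    are multiples of one nonzero pair, whose slope [b / a] is the parameter of the graph, while
    [a = 0] gives [Minf]. *)
Lemma Lat_Alg_TU_sub N : Lat (Alg (TU M0 Minf U)) N ->
  [\/ exists w, N = graph_subspace M0 U w, N = Minf, N = [set 0] | N = setT].
Proof.
move=> [sN Ninv].
have [N0|nN0] := pselect (N = [set 0]); first by constructor 3.
pose E a b := forall z, M0 z -> N (a *: z + b *: U z).
have EF x y (F : X -> R[i]) : N (x + U y) -> M0 x -> M0 y ->
    (forall (a : R[i]) u v, F (a *: u + v) = a * F u + F v) ->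
    (exists2 C : R, 0 <= C & forall v, complex.Re `|F v| <= C * nrm v) -> E (F x) (F y).
  move=> Nxy Mx My FL FC z Mz.
  have [A AT <-//] := Alg_TU_rank_one F z FL FC Mz.
  by apply: (Ninv A AT); exists (x + U y).
(* A nonzero vector of [N] has a nonzero coordinate, and a functional not vanishing there yields a
   nonzero pair. *)
have [a [b [ab Eab]]] : exists a b : R[i], (a != 0) || (b != 0) /\ E a b.
  have [v Nv v0] : exists2 v, N v & v <> 0.
    apply: contrapT => nv; apply: nN0; apply/seteqP; split=> [v Nv|v ->].
      by apply: contrapT => v0; apply: nv; exists v.
    exact: subspace0.
  have [x [y [Mx My vE]]] := decomp v; rewrite vE in Nv.
  have [x0|x0] := pselect (x = 0); last first.
    have [F [FL FC /eqP Fx]] := separating_functional x x0.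
    by exists (F x), (F y); rewrite Fx; split=> //; exact: EF.
  have y0 : y <> 0 by move=> y0; apply: v0; rewrite vE x0 y0 U0 addr0.
  have [F [FL FC /eqP Fy]] := separating_functional y y0.
  by exists (F x), (F y); rewrite Fy orbT; split=> //; exact: EF.
have [[a' [b' [Eab' nd]]]|all_prop] :=
    pselect (exists a' b' : R[i], E a' b' /\ a * b' - a' * b != 0).
  constructor 4; apply/seteqP; split=> // v _.
  have [x [y [Mx My ->]]] := decomp v.
  move dE : (a * b' - a' * b) nd => d nd.
  have comb c c' u w : c *: (a *: u + b *: w) + c' *: (a' *: u + b' *: w) =
      (c * a + c' * a') *: u + (c * b + c' * b') *: w :> X.
    by rewrite !scalerDr !scalerA addrACA -!scalerDl.
  have Ecomb c c' z : M0 z -> N ((c * a + c' * a') *: z + (c * b + c' * b') *: U z).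
    move=> Mz; rewrite -comb; apply: subspaceL => //; first exact: Eab.
    by apply: subspaceZ => //; exact: Eab'.
  (* Cramer's rule with determinant [d]: this combination of the two pairs is [(1, 0)], the next one
     is [(0, 1)]. *)
  have Nx : N x.
    have := Ecomb (b' / d) (- b / d) x Mx.
    have -> : b' / d * a + - b / d * a' = d / d by rewrite -{3}dE; ring.
    have -> : b' / d * b + - b / d * b' = 0 by ring.
    by rewrite divff// scale1r scale0r addr0.
  have Ny : N (U y).
    have := Ecomb (- a' / d) (a / d) y My.
    have -> : - a' / d * a + a / d * a' = 0 by ring.
    have -> : - a' / d * b + a / d * b' = d / d by rewrite -{3}dE; ring.
    by rewrite divff// scale1r scale0r add0r.
  exact: subspaceD.
(* Otherwise a functional not vanishing at [a *: y - b *: x] would give a pair independent of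
   [(a, b)]. *)
have line x y : N (x + U y) -> M0 x -> M0 y -> a *: y = b *: x.
  move=> Nxy Mx My; apply/subr0_eq; apply: contrapT => ne.
  have [F [FL FC]] := separating_functional _ ne; apply.
  have FZ c u : F (c *: u) = c * F u.
    have F0 := functional0 F FL.
    by rewrite -[c *: u]addr0 FL F0 addr0.
  rewrite addrC -scaleN1r FL !FZ mulN1r addrC.
  apply/eqP; apply: contrapT => /negP ne'; apply: all_prop.
  exists (F x), (F y); split; first exact: EF.
  by rewrite (mulrC (F x)).
have [a0|a0] := eqVneq a 0; last first.
  constructor 1; exists (b / a); apply/seteqP; split=> v.
  - move=> Nv; have [x [y [Mx My vE]]] := decomp v; exists x => //.
    have /(congr1 (GRing.scale a^-1)) : a *: y = b *: x by apply: line; rewrite -?vE.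
    rewrite !scalerA mulVf// scale1r mulrC => yE.
    by rewrite vE yE UZ.
  - move=> [x Mx <-].
    have -> : x + (b / a) *: U x = a^-1 *: (a *: x + b *: U x).
      by rewrite scalerDr !scalerA mulVf// scale1r mulrC.
    by apply: subspaceZ => //; exact: Eab.
have b0 : b != 0 by move: ab; rewrite a0 eqxx.
constructor 2; apply/seteqP; split=> v.
- move=> Nv; have [x [y [Mx My vE]]] := decomp v.
  have := line x y; rewrite -vE => /(_ Nv Mx My); rewrite a0 scale0r.
  move=> /esym/eqP; rewrite scaler_eq0 (negbTE b0) /= => /eqP x0.
  by rewrite vE x0 add0r; exact: UM.
- move=> /U_surj[y My <-]; rewrite -[U y](scalerK b0).
  apply: subspaceZ => //; have := Eab y My.
  by rewrite a0 scale0r add0r.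
Qed.

Lemma Lat_Alg_TU : Lat (Alg (TU M0 Minf U)) =
  (range (graph_subspace M0 U) `|` [set Minf]) `|` [set [set 0]; setT].
Proof.
apply/seteqP; split=> [N /Lat_Alg_TU_sub[[w ->]|->|->|->]|N].
- by left; left; exists w.
- by left; right.
- by right; left.
- by right; right.
- move=> [[[w _ <-]|->]|[->|->]].
  + exact: Lat_Alg_graph.
  + by apply: sub_Lat_Alg => //; left; right.
  + by apply: sub_Lat_Alg; [exact: is_subspace_set0 | do 4 left].
  + by apply: sub_Lat_Alg; [exact: is_subspace_setT | right].
Qed.

(** The graph for [2] is invariant, and comparison of coordinates tells it from all five members. *)
Lemma TU_not_reflexive : (exists v : X, v <> 0) -> ~ reflexive_lattice (TU M0 Minf U).
Proof.
move=> [v v0]; rewrite /reflexive_lattice => LA.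
have [x Mx x0] : exists2 x, M0 x & x <> 0.
  apply: contrapT => nx; apply: v0; have [x [y [Mx My ->]]] := decomp v.
  have Z z : M0 z -> z = 0.
    by move=> Mz; apply: contrapT => z0; apply: nx; exists z.
  by rewrite (Z _ Mx) (Z _ My) U0 addr0.
have M00 := subspace0 _ sM0.
have G2 : graph_subspace M0 U 2 (x + 2 *: U x) by exists x.
have M2x : M0 (2 *: x) by exact: subspaceZ.
have two0 : (2 : R[i]) *: x <> 0.
  by apply/eqP; rewrite scaler_eq0 pnatr_eq0 /=; exact/eqP.
have := Lat_Alg_graph 2; rewrite LA => -[[[[G|G]|G]|G]|G].
- have : x + U (2 *: x) = 0 + U 0 by rewrite UZ// U0 addr0; move: G2; rewrite G.
  by move=> /(coordinates_unique _ _ _ _ Mx M2x M00 M00)[].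
- move: G2; rewrite G => Mv.
  have : x + U (2 *: x) = (x + 2 *: U x) + U 0 by rewrite UZ// U0 addr0.
  by move=> /(coordinates_unique _ _ _ _ Mx M2x Mv M00)[].
- move: G2; rewrite G => -[y My]; rewrite scale1r -UZ//.
  move=> /(coordinates_unique _ _ _ _ My My Mx M2x)[-> /eqP].
  rewrite -subr_eq0 -{1}[x]scale1r -scalerBl scaler_eq0 => /orP[|/eqP//].
  by rewrite (_ : 1 - 2 = -1) ?oppr_eq0 ?oner_eq0//; ring.
- move: G2; rewrite G => /U_surj[y My]; rewrite -UZ// -[U y]add0r.
  by move=> /(coordinates_unique _ _ _ _ M00 My Mx M2x)[/esym].
(* Were the graph the whole space, it would contain [x], whose second coordinate is [0] and not
   [2 *: x]. *)
- have : graph_subspace M0 U 2 x by rewrite G.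
  move=> [y My]; rewrite -UZ// => yx; have M2y : M0 (2 *: y) by exact: subspaceZ.
  have : y + U (2 *: y) = x + U 0 by rewrite yx U0 addr0.
  by move=> /(coordinates_unique _ _ _ _ My M2y Mx M00)[->].
Qed.

End GraphLattice.

(** * Closedness of linear subspaces in finite dimension *)

Section FiniteDimension.
Context {R : realType} {X : normedModType R[i]}.
Implicit Types (S M : set X).

(* [S] is the sum of [M], which lies in the kernel of [F], and of the line
   through [u]; the coordinate of a limit point along [u] is read off by [F],
   so the completeness of the scalar field is not used. *)
Lemma closed_add_line M S (F : X -> R[i]) u :
  (forall (a : R[i]) y z, F (a *: y + z) = a * F y + F z) ->
  (exists2 C : R, 0 <= C & forall y, complex.Re `|F y| <= C * nrm y) -> F u != 0 ->
  is_subspace M -> M `<=` S -> S u ->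
  S 0 -> (forall (a : R[i]) x y, S x -> S y -> S (a *: x + y)) ->
  (forall x, S x -> M (x - (F x / F u) *: u)) -> is_subspace S.
Proof.
move=> FL [C C0 FC] Fu sM MS Su S0 SL SM.
apply/is_subspaceP; split=> // x xlim.
have FB y z : F (y - z) = F y - F z.
  by rewrite addrC -scaleN1r FL mulN1r addrC.
(* The projection onto the kernel of [F] along [u]; the constant [K] below bounds it. *)
pose phi y := y - (F y / F u) *: u.
have phiB y z : phi y - phi z = phi (y - z).
  by rewrite /phi FB mulrBl scalerBl !opprD !opprK addrACA.
pose K := 1 + C * complex.Re `|(F u)^-1| * nrm u.
have Fu0 : 0 <= complex.Re `|(F u)^-1| by rewrite -ler0c RRe_real ?normr_real.
have K0 : 0 < K by rewrite ltr_pwDl// !mulr_ge0// nrm_ge0.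
have phiK y : nrm (phi y) <= K * nrm y.
  apply: le_trans (ler_nrmD _ _) _; rewrite nrmN nrmZ.
  rewrite mulrDl mul1r lerD2l; set r := complex.Re `|(F u)^-1| in Fu0 *.
  have -> : complex.Re `|F y / F u| = complex.Re `|F y| * r.
    exact: Re_normrM.
  have -> : C * r * nrm u * nrm y = C * nrm y * r * nrm u by ring.
  by rewrite ler_wpM2r ?nrm_ge0// ler_wpM2r.
have Mphi : M (phi x).
  apply: (subspace_closed _ sM) => e e0.
  have [y Sy xy] := xlim (e / K) (divr_gt0 e0 K0).
  exists (phi y); first exact: SM.
  by rewrite phiB; apply: le_lt_trans (phiK _) _; rewrite mulrC -ltr_pdivlMr.
have -> : x = (F x / F u) *: u + phi x by rewrite addrC subrK.
by apply: SL => //; exact: MS.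
Qed.

(** The family may lie outside [S]; this lets the induction pass to the kernel of [F] in [S] with
    the projected vectors [phi (e' i)]. *)
Lemma finite_span_closed n (e : 'I_n -> X) S :
  S 0 -> (forall (a : R[i]) x y, S x -> S y -> S (a *: x + y)) ->
  (forall x, S x -> exists c : 'I_n -> R[i], x = \sum_(i < n) c i *: e i) ->
  is_subspace S.
Proof.
elim: n e S => [|n IH] e S S0 SL Se.
  have -> : S = [set 0].
    by apply/seteqP; split=> [x /Se[c ->]|_ ->//] /=; rewrite big_ord0.
  exact: is_subspace_set0.
pose e' i := e (lift ord0 i).
(* Either the first vector is redundant for [S], or some [u] in [S] has a nonzero coordinate along
   it. *)
have [Se'|] := pselect (forall x, S x -> exists c : 'I_n -> R[i],
    x = \sum_(i < n) c i *: e' i); first exact: IH Se'.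
move=> /existsNP[u /not_implyP[Su nu]].
have [c uE] := Se u Su; rewrite big_ord_recl in uE.
have c0 : c ord0 != 0.
  apply/eqP => c0; apply: nu; exists (fun i => c (lift ord0 i)).
  by rewrite uE c0 scale0r add0r.
have u0 : u <> 0.
  by move=> u0; apply: nu; exists (fun=> 0); rewrite u0 big1// => i _; rewrite scale0r.
have [F [FL FC /eqP Fu]] := separating_functional u u0.
have F0 := functional0 F FL.
pose phi y := y - (F y / F u) *: u.
have phiL a y z : phi (a *: y + z) = a *: phi y + phi z.
  by rewrite /phi FL mulrDl scalerDl opprD addrACA scalerBr scalerA mulrA.
have phi0 : phi 0 = 0 by rewrite /phi F0 mul0r scale0r subr0.
have phiu : phi u = 0 by rewrite /phi divff// scale1r subrr.
have phi_sum (d : 'I_n -> R[i]) :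
    phi (\sum_(i < n) d i *: e' i) = \sum_(i < n) d i *: phi (e' i).
  by apply: (big_rec2 (fun a b => phi a = b)) => // i a b _ <-; rewrite phiL.
pose M := [set x | S x /\ F x = 0].
have M_e x : M x -> exists d : 'I_n -> R[i], x = \sum_(i < n) d i *: phi (e' i).
  move=> [Sx Fx]; have [d xE] := Se x Sx; rewrite big_ord_recl in xE.
  (* Subtracting [t *: u] from [x] removes the coordinate along [e ord0]; [phi] kills [u] and fixes
     [x], where [F] vanishes. *)
  pose t := d ord0 / c ord0.
  exists (fun i => d (lift ord0 i) - t * c (lift ord0 i)).
  rewrite -phi_sum.
  have -> : \sum_(i < n) (d (lift ord0 i) - t * c (lift ord0 i)) *: e' i = - t *: u + x.
    rewrite uE xE scalerDr scalerA mulNr /t divfK// addrACA scaleNr addNr add0r.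
    rewrite scaler_sumr -big_split /=; apply: eq_bigr => i _.
    by rewrite scalerA -scalerDl mulNr addrC.
  by rewrite phiL phiu scaler0 add0r /phi Fx mul0r scale0r subr0.
have sM : is_subspace M.
  apply: (IH (fun i => phi (e' i))) => //.
  move=> a x y [Sx Fx] [Sy Fy]; split; first exact: SL.
  by rewrite FL Fx Fy mulr0 addr0.
apply: (closed_add_line M S F u) => //; first by move=> x [].
move=> x Sx; split.
  by rewrite addrC -scaleNr; exact: SL.
by rewrite addrC -scaleNr FL mulNr divfK// addNr.
Qed.

Lemma sum_set_closed M N : finite_dimensional X -> is_subspace M ->
  is_subspace N -> is_subspace (sum_set M N).
Proof.
move=> [n [e eX]] sM sN; apply: (finite_span_closed n e) => //.
  exists 0; first exact: subspace0.
  by exists 0; [exact: subspace0 | rewrite addr0].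
move=> a _ _ [x Mx [y Ny <-]] [x' Mx' [y' Ny' <-]].
exists (a *: x + x'); first exact: subspaceL.
exists (a *: y + y'); first exact: subspaceL.
by rewrite scalerDr addrACA.
Qed.

End FiniteDimension.

(** * Double triangles in finite dimension *)

Section DoubleTriangle.
Context {R : realType} {X : completeNormedModType R[i]}.
Implicit Types (K L M : set X).

(* [U k] is minus the component of [k] in [M] along [L]; when also [X = K + M],
   the graph of [U] is [L]. *)
Lemma complement_graph_map K L M :
  is_subspace K -> is_subspace L -> is_subspace M ->
  L `&` M = [set 0] -> sum_set L M = setT ->
  exists2 U : X -> X, bounded_linear_on K M U &
    forall k l m, K k -> L l -> M m -> l = k + m -> U k = m.
Proof.
move=> sK sL sM LM LMT.
have [P [LP MP PL [C PC]]] := complement_projection _ _ sL sM LM LMT.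
exists (fun k => P k - k).
  split.
  - by move=> _ [k _ <-]; rewrite -opprB; exact: subspaceN.
  - by move=> a x y _ _; rewrite PL opprD addrACA -scalerBr.
  - apply/bounded_onP; exists (`|C| + 1) => [|x _]; first by rewrite addr_ge0.
    apply: le_trans (ler_nrmD _ _) _; rewrite nrmN mulrDl mul1r lerD2r.
    by apply: le_trans (PC x) _; rewrite ler_wpM2r ?nrm_ge0 ?ler_norm.
move=> k l m Kk Ll Mm lE.
have kE : P k + (k - P k) = l - m by rewrite subrKC lE addrK.
have [-> _] := direct_sum_unique _ _ _ _ _ _ sL sM LM (LP k) (MP k) Ll (subspaceN _ sM _ Mm) kE.
by rewrite lE addrC addKr.
Qed.

(** [L] is a graph over [K] and also over [M]: exchanging the roles of [K] and [M] in
    [complement_graph_map] gives the inverse of [U]. *)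
Lemma double_triangle_TU (T : set (set X)) : finite_dimensional X ->
  double_triangle T -> exists M0 Minf U,
    [/\ is_subspace M0, is_subspace Minf, M0 `&` Minf = [set 0],
        sum_set M0 Minf = setT & invertible_on M0 Minf U /\ T = TU M0 Minf U].
Proof.
move=> fdX [K [L [M [[sK sL sM] _ [KL KM LM] [jKL jKM jLM] ->]]]].
(* Sums of subspaces are closed here, so joins are algebraic sums. *)
have sumT (A B : set X) : is_subspace A -> is_subspace B -> join A B = setT -> sum_set A B = setT.
  by move=> sA sB <-; apply/closure_id; case: (sum_set_closed A B fdX sA sB).
have KMT := sumT _ _ sK sM jKM; have LMT := sumT _ _ sL sM jLM.
have LKT : sum_set L K = setT.
  rewrite -(sumT _ _ sK sL jKL); apply/seteqP.
  by split=> _ [x Ax [y By <-]]; exists y => //; exists x => //; rewrite addrC.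
have LK : L `&` K = [set 0] by rewrite setIC.
have [U Ubd UE] := complement_graph_map K L M sK sL sM LM LMT.
have [V Vbd VE] := complement_graph_map M L K sM sL sK LK LKT.
have UV k : K k -> M (U k) /\ L (k + U k).
  move=> Kk; have : sum_set L M k by rewrite LMT.
  move=> [l Ll [m Mm klm]].
  (* Read as [l = k + (- m)], this gives [U k = - m]. *)
  have e : l = k - m by rewrite -klm addrK.
  have := UE k l (- m) Kk Ll (subspaceN _ sM _ Mm) e => ->.
  by rewrite -e; split=> //; exact: subspaceN.
have VU m : M m -> K (V m) /\ L (V m + m).
  move=> Mm; have : sum_set L K m by rewrite LKT.
  move=> [l Ll [k Kk mlk]].
  have e : l = m - k by rewrite -mlk addrK.
  have := VE m l (- k) Mm Ll (subspaceN _ sK _ Kk) e => ->.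
  by rewrite addrC -e; split=> //; exact: subspaceN.
exists K, M, U; split=> //; split.
  split=> //; exists V; split=> //.
  - move=> k Kk; have [MU LU] := UV k Kk.
    by apply: (VE _ _ _ MU LU Kk); rewrite addrC.
  - move=> m Mm; have [KV LV] := VU m Mm.
    exact: (UE _ _ _ KV LV Mm).
rewrite /TU; suff -> : graph_subspace K U 1 = L by [].
apply/seteqP; split=> [_ [k Kk <-]|l Ll].
  by rewrite scale1r; case: (UV k Kk).
have : sum_set K M l by rewrite KMT.
move=> [k Kk [m Mm klm]]; exists k => //; rewrite scale1r.
by rewrite (UE k l m).
Qed.

Lemma double_triangle_neq0 (T : set (set X)) :
  double_triangle T -> exists v : X, v <> 0.
Proof.
move=> [K [L [M [[sK _ _] + _ _ _]]]] /= => /andP[+ _].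
rewrite inE negb_or => /andP[/eqP K0 _]; apply: contrapT => nv; apply: K0.
have z x : x = 0 :> X by apply: contrapT => x0; apply: nv; exists x.
apply/seteqP; split=> x _ //=; rewrite (z x) //; exact: subspace0.
Qed.

End DoubleTriangle.

Theorem theorem5 (R : realType) :
  (forall (X : completeNormedModType R[i]) (M0 Minf : set X) (U : X -> X),
      dim_at_least X 2%N ->
      is_subspace M0 -> is_subspace Minf ->
      M0 `&` Minf = [set 0] -> sum_set M0 Minf = setT ->
      invertible_on M0 Minf U ->
      ~ reflexive_lattice (TU M0 Minf U) /\
      Lat (Alg (TU M0 Minf U)) =
        (range (graph_subspace M0 U) `|` [set Minf]) `|` [set [set 0]; setT]) /\
  (forall (X : completeNormedModType R[i]) (T : set (set X)),
      finite_dimensional X -> double_triangle T -> ~ reflexive_lattice T).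
Proof.
split=> [X M0 Minf U [e e_free] sM0 sMinf cap sum invU|X T fdX dT].
  split; last exact: Lat_Alg_TU.
  apply: TU_not_reflexive => //; apply: contrapT => nv.
  (* In a zero space, coefficients all equal to [1] would contradict the independence of [e]. *)
  have /eqP : (1 : R[i]) = 0; last by rewrite oner_eq0.
  apply: (e_free (fun=> 1) _ ord0); rewrite big1// => i _.
  by apply: contrapT => ei; apply: nv; exists (1 *: e i).
have [M0 [Minf [U [sM0 sMinf cap sum [invU ->]]]]] := double_triangle_TU T fdX dT.
apply: TU_not_reflexive => //; exact: double_triangle_neq0 dT.
Qed.
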